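(* If $G$ is a connected $(P_5,\mathrm{paw})$-free graph, then $\gamma_s(G) \le \max\{3,\alpha(G)\}$.
   Context: All graphs are finite, simple and undirected. $P_n$ denotes the path on $n$ vertices. The paw is the graph on four vertices obtained from a triangle by adding one new vertex adjacent to exactly one vertex of the triangle. A graph is $(H_1,H_2)$-free if it has no induced subgraph isomorphic to $H_1$ or to $H_2$. A set $S\subseteq V(G)$ is a dominating set of $G$ if every vertex of $V(G)\setminus S$ is adjacent to at least one vertex of $S$. A secure dominating set of $G$ is a dominating set $S$ of $G$ such that for every $v\in V(G)\setminus S$ there is a neighbor $u$ of $v$ in $S$ such that $(S\setminus\{u\})\cup\{v\}$ is a dominating set of $G$. The secure domination number $\gamma_s(G)$ is the minimum cardinality of a secure dominating set of $G$, and the independence number $\alpha(G)$ is the maximum cardinality of an independent set of $G$. *)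

(* Defs.v *)
(* A finite simple graph is a symmetric irreflexive relation
   [e : rel T] on a finite type [T]. *)
From mathcomp Require Import all_boot.

Set Implicit Arguments.
Unset Strict Implicit.
Unset Printing Implicit Defensive.

Definition connected_graph (T : finType) (e : rel T) : Prop :=
  forall x y : T, connect e x y.

Definition graph_iso (T U : finType) (e : rel T) (h : rel U) : Prop :=
  exists2 f : T -> U, bijective f & forall x y, h (f x) (f y) = e x y.

Definition induced (T : finType) (e : rel T) (A : {set T}) :
  rel {x : T | x \in A} := fun x y => e (val x) (val y).

Definition induced_free (T U : finType) (e : rel T) (h : rel U) : Prop :=
  ~ exists A : {set T}, graph_iso (@induced T e A) h.

Definition path_graph (n : nat) : rel 'I_n :=
  fun i j => (i.+1 == j :> nat) || (j.+1 == i :> nat).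

(* [Some _] are the vertices of the triangle, [None] is the added vertex. *)
Definition paw : rel (option 'I_3) := fun u v =>
  match u, v with
  | Some i, Some j => i != j
  | Some i, None | None, Some i => i == ord0
  | None, None => false
  end.

Definition dominating (T : finType) (e : rel T) (S : {set T}) : bool :=
  [forall v in ~: S, [exists u in S, e v u]].

Definition secure_dominating (T : finType) (e : rel T) (S : {set T}) : bool :=
  dominating e S &&
  [forall v in ~: S, [exists u in S, e v u && dominating e (v |: (S :\ u))]].

Definition independent (T : finType) (e : rel T) (S : {set T}) : bool :=
  [forall x in S, forall y in S, ~~ e x y].

Lemma secure_dominating_setT (T : finType) (e : rel T) :
  secure_dominating e [set: T].
Proof.
by apply/andP; split; apply/forallP => v; rewrite setCT inE.
Qed.

(* [setT] only witnesses that the minimum is over a nonempty family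
   ([secure_dominating_setT]). *)
Definition secure_domination_number (T : finType) (e : rel T) : nat :=
  #|[arg min_(S < [set: T] | secure_dominating e S) #|S|]|.

Lemma secure_domination_numberP (T : finType) (e : rel T) :
  (exists2 S, secure_dominating e S & #|S| = secure_domination_number e) /\
  (forall S, secure_dominating e S -> secure_domination_number e <= #|S|).
Proof.
rewrite /secure_domination_number.
case: arg_minnP => [|S Ssec Smin]; first exact: secure_dominating_setT.
by split=> //; exists S.
Qed.

Definition independence_number (T : finType) (e : rel T) : nat :=
  \max_(S : {set T} | independent e S) #|S|.

(* Main.v *)
Require Import Defs.
From mathcomp Require Import all_boot.

(** The proof splits on whether [G] contains a triangle.

    If it does, paw-freeness says that a vertex with one neighbour in a
    triangle has at least two there.  This spreads along edges, so by
    connectivity every vertex has two neighbours in one fixed triangle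
    ([triangle_two_neighbours]); hence any two of its corners dominate the
    graph, and the triangle is secure ([triangle_secure]), whence the bound 3.

    Let [G] be triangle-free.  Neighbourhoods are then independent, so any
    secure dominating set of the form [N(x)] is within the bound.  Choose an
    edge [ab] for which [N(a) :|: N(b)] is as large as possible.  If this is
    not the whole vertex set, a vertex just outside yields either an induced
    5-cycle or an edge with a larger union ([dominating_edge_or_cycle5]).

    - If [N(a) :|: N(b)] is everything, [G] is bipartite with sides
      [N(b)] (containing [a]) and [N(a)].  Let [L] be the set of vertices whose
      only neighbour is [a].  When [L] is empty the independent side [N(b)] is
      secure.  Otherwise [N(b)] together with all of [L] but one vertex is
      secure, and it has as many elements as the independent set obtained from
      [N(b) :|: L] by removing [a] ([dominating_edge_bound]).

    - If there is a 5-cycle [c0 c1 c2 c3 c4], every vertex is adjacent to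
      exactly the two cycle-neighbours of some [c_i] ([cycle5_classes]): the
      graph is a 5-cycle with vertices multiplied.  If it is the bare cycle,
      three vertices suffice.  Otherwise some [c_i], say [c0], has a twin [w];
      since [w] can take over the role of [c0] after a swap, one of the two
      neighbourhoods [N(c4)] and [N(c1)], both containing the twins [c0] and
      [w], is secure ([cycle5_twin_bound]). *)

Set Implicit Arguments.
Unset Strict Implicit.
Unset Printing Implicit Defensive.

(** * Forbidden induced subgraphs as conditions on vertices *)

(** Injectivity of [g] need not be checked when no two vertices of [h] have the
    same neighbourhood: equal images would have equal adjacencies. *)
Lemma induced_embedding (T U : finType) (e : rel T) (h : rel U) (g : U -> T) :
  (forall i j, h i =1 h j -> i = j) ->
  (forall i j, e (g i) (g j) = h i j) ->
  exists A : {set T}, graph_iso (@induced T e A) h.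
Proof.
move=> h_sep gP.
have g_inj : injective g.
  by move=> i j eq_g; apply: h_sep => k; rewrite -!gP eq_g.
exists [set g i | i : U].
have gin i : g i \in [set g i | i : U] by apply: imset_f.
pose g' i : {x : T | x \in [set g i | i : U]} := exist _ (g i) (gin i).
have g'_inj : injective g' by move=> i j [/g_inj].
have g'_bij : bijective g'.
  by apply: inj_card_bij g'_inj _; rewrite card_sig card_imset.
case: g'_bij => f g'K fK; exists f; first by exists g'.
by move=> x y; rewrite -gP -{2}(fK x) -{2}(fK y).
Qed.

Lemma paw_twin_free u v : paw u =1 paw v -> u = v.
Proof.
move: u v => [[[|[|[|//]]] i3]|] [[[|[|[|//]]] j3]|] eq_h;
  try (by congr Some; apply: val_inj).
all: have := eq_h None; have := eq_h (Some (Ordinal (isT : 0 < 3)));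
  have := eq_h (Some (Ordinal (isT : 1 < 3)));
  by have := eq_h (Some (Ordinal (isT : 2 < 3))).
Qed.

Lemma path_graph5_twin_free i j : path_graph (n := 5) i =1 path_graph j -> i = j.
Proof.
move: i j => [[|[|[|[|[|//]]]]] i5] [[|[|[|[|[|//]]]]] j5] eq_h;
  try (by apply: val_inj).
all: have := eq_h (Ordinal (isT : 0 < 5));
  have := eq_h (Ordinal (isT : 1 < 5));
  have := eq_h (Ordinal (isT : 2 < 5));
  by have := eq_h (Ordinal (isT : 3 < 5)).
Qed.

Lemma paw_free_triangle (T : finType) (e : rel T) :
  symmetric e -> irreflexive e -> induced_free e paw ->
  forall a b c v, e a b -> e b c -> e a c -> e v a -> e v b || e v c.
Proof.
move=> e_sym e_irr noPaw a b c v ab bc ac va.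
apply: contra_notT noPaw; rewrite negb_or => /andP[/negbTE vb /negbTE vc].
pose g (o : option 'I_3) := if o is Some i then nth a [:: a; b; c] i else v.
apply: (induced_embedding (g := g) paw_twin_free).
move=> [[[|[|[|//]]] i3]|] [[[|[|[|//]]] j3]|] /=;
  rewrite ?e_irr // ?ab ?bc ?ac ?va ?vb ?vc //;
  by rewrite e_sym ?ab ?bc ?ac ?va ?vb ?vc.
Qed.

Lemma P5_free_path (T : finType) (e : rel T) :
  symmetric e -> irreflexive e -> induced_free e (@path_graph 5) ->
  forall v0 v1 v2 v3 v4, e v0 v1 -> e v1 v2 -> e v2 v3 -> e v3 v4 ->
  [|| e v0 v2, e v1 v3, e v2 v4, e v0 v3, e v1 v4 | e v0 v4].
Proof.
move=> e_sym e_irr noP5 v0 v1 v2 v3 v4 e01 e12 e23 e34.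
apply: contra_notT noP5.
rewrite !negb_or => /and5P[/negbTE e02 /negbTE e13 /negbTE e24 /negbTE e03].
move=> /andP[/negbTE e14 /negbTE e04].
pose g (i : 'I_5) := nth v0 [:: v0; v1; v2; v3; v4] i.
apply: (induced_embedding (g := g) path_graph5_twin_free).
move=> [[|[|[|[|[|//]]]]] i5] [[|[|[|[|[|//]]]]] j5];
  rewrite /g /path_graph /= ?e_irr // ?e01 ?e12 ?e23 ?e34 ?e02 ?e13 ?e24
    ?e03 ?e14 ?e04 //;
  by rewrite e_sym ?e01 ?e12 ?e23 ?e34 ?e02 ?e13 ?e24 ?e03 ?e14 ?e04.
Qed.

(** * Bounding the secure domination number *)

(** After the swap of [u] for [v], the vertex [u] itself is dominated by [v],
    so only the other vertices outside [S] have to be looked after. *)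
Lemma secure_dominating_swap (T : finType) (e : rel T) (S : {set T}) :
  symmetric e ->
  (forall v, v \notin S -> exists u, [/\ u \in S, e v u &
     forall w, w \notin S -> w != v ->
       exists x, [/\ x \in S, x != u & e w x]]) ->
  secure_dominating e S.
Proof.
move=> e_sym swap; apply/andP; split.
  apply/forall_inP => v; rewrite inE => /swap[u [uS vu _]].
  by apply/exists_inP; exists u.
apply/forall_inP => v; rewrite inE => /swap[u [uS vu dom]].
apply/exists_inP; exists u; rewrite // vu.
apply/forall_inP => w; rewrite !inE negb_or negb_and negbK => /andP[wv wuS].
apply/exists_inP; case/orP: wuS => [/eqP-> | wS].
  by exists v; rewrite ?inE ?eqxx // e_sym.
by have [x [xS xu wx]] := dom w wS wv; exists x; rewrite // !inE xu xS orbT.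
Qed.

Lemma secure_domination_leq (T : finType) (e : rel T) (S : {set T}) m :
  secure_dominating e S -> #|S| <= m -> secure_domination_number e <= m.
Proof. by move/(secure_domination_numberP e).2; apply: leq_trans. Qed.

Lemma leq_independence_number (T : finType) (e : rel T) (S : {set T}) :
  {in S &, forall x y, ~~ e x y} -> #|S| <= independence_number e.
Proof.
move=> indS; apply: (leq_bigmax_cond (F := fun S : {set T} => #|S|)).
by apply/forall_inP => x xS; apply/forall_inP => y yS; apply: indS.
Qed.

Lemma leq_cards3 (T : finType) (a b c : T) : #|[set a; b; c]| <= 3.
Proof. by rewrite -setUA cardsU1 cards2; case: (a \notin _); case: (b != c). Qed.

Lemma connected_closed (T : finType) (e : rel T) (P : pred T) (x : T) :
  connected_graph e -> P x -> (forall u v, e u v -> P u -> P v) ->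
  forall v, P v.
Proof.
move=> conn Px closedP v; have /connectP[p] := conn x v.
elim: p x Px => [|y p IHp] x Px /=; first by move=> _ ->.
by case/andP=> /closedP/(_ Px)/IHp{}IHp /IHp.
Qed.

(** * Graphs containing a triangle *)

Lemma triangle_two_neighbours (T : finType) (e : rel T) (a b c : T) :
  symmetric e -> irreflexive e -> connected_graph e -> induced_free e paw ->
  e a b -> e b c -> e a c ->
  forall v, [|| e v a && e v b, e v a && e v c | e v b && e v c].
Proof.
move=> e_sym e_irr conn noPaw ab bc ac.
have paw := paw_free_triangle e_sym e_irr noPaw.
have [ba cb ca] : [/\ e b a, e c b & e c a] by split; rewrite e_sym.
apply: (connected_closed (x := a)) conn _ _; first by rewrite ab ac !orbT.
move=> u v uv two_u; have vu : e v u by rewrite e_sym.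
(* [u] spans a triangle with two of the corners, and [v] is attached to it. *)
have: [|| e v a, e v b | e v c].
  case/or3P: two_u => /andP[ux uy].
  - by case/orP: (paw _ _ _ _ ux ab uy vu) => ->; rewrite ?orbT.
  - by case/orP: (paw _ _ _ _ ux ac uy vu) => ->; rewrite ?orbT.
  - by case/orP: (paw _ _ _ _ ux bc uy vu) => ->; rewrite ?orbT.
case/or3P=> vx; rewrite vx /=.
- by rewrite orbA (paw a b c).
- by have /orP[->|->] := paw b a c v ba ac bc vx; rewrite ?orbT.
- by have /orP[->|->] := paw c a b v ca ab cb vx; rewrite ?orbT.
Qed.

Lemma triangle_secure (T : finType) (e : rel T) (a b c : T) :
  symmetric e -> irreflexive e -> connected_graph e -> induced_free e paw ->
  e a b -> e b c -> e a c -> secure_dominating e [set a; b; c].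
Proof.
move=> e_sym e_irr conn noPaw ab bc ac.
have two := triangle_two_neighbours e_sym e_irr conn noPaw ab bc ac.
have neq x y : e x y -> (x != y) * (y != x).
  by move=> xy; rewrite eq_sym; split; apply/eqP=> eq_xy; rewrite eq_xy e_irr in xy.
have [a_b b_c a_c] := And3 (neq _ _ ab) (neq _ _ bc) (neq _ _ ac).
apply: secure_dominating_swap => // v _.
have [va | nva] := boolP (e v a).
  exists a; split; rewrite ?inE ?eqxx // => w _ _.
  case/or3P: (two w) => /andP[wx wy]; [exists b | exists c | exists c];
    by rewrite ?inE ?eqxx ?a_b ?b_c ?a_c ?orbT.
have vb : e v b by have := two v; rewrite (negbTE nva) /= => /andP[].
exists b; split; rewrite ?inE ?eqxx ?orbT // => w _ _.
case/or3P: (two w) => /andP[wx wy]; [exists a | exists c | exists c];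
  by rewrite ?inE ?eqxx ?a_b ?b_c ?a_c ?orbT.
Qed.

(** * Triangle-free graphs without induced five-vertex paths *)

Section TriangleFree.

Variables (T : finType) (e : rel T).
Hypotheses (e_sym : symmetric e) (e_conn : connected_graph e).
Hypothesis no_triangle : forall x y z, e x y -> e y z -> e x z = false.
(* The other chords of the path would close a triangle. *)
Hypothesis no_P5 : forall v0 v1 v2 v3 v4,
  e v0 v1 -> e v1 v2 -> e v2 v3 -> e v3 v4 ->
  [|| e v0 v3, e v1 v4 | e v0 v4].

Local Notation N x := [set y | e x y].

(** Such a cycle is induced, since a chord would close a triangle. *)
Definition cycle5 (c0 c1 c2 c3 c4 : T) :=
  [&& e c0 c1, e c1 c2, e c2 c3, e c3 c4 & e c4 c0].

Lemma cycle5_rot c0 c1 c2 c3 c4 :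
  cycle5 c0 c1 c2 c3 c4 -> cycle5 c1 c2 c3 c4 c0.
Proof. by case/and5P=> *; apply/and5P. Qed.

Lemma no_loop x : e x x = false.
Proof. by apply/negP => xx; have := no_triangle xx xx; rewrite xx. Qed.

Lemma card_neighbourhood x : #|N x| <= independence_number e.
Proof.
apply: leq_independence_number => y z; rewrite !inE => xy xz.
by rewrite (@no_triangle y x z) // e_sym.
Qed.

(** A vertex [w] missed by the best edge [ab], adjacent to [x] in [N(a)], gives
    for each other neighbour [y] of [b] the path [w x a b y].  Either [wy]
    closes it to a 5-cycle, or [xy] is an edge; if the latter holds for all [y],
    the edge [ax] dominates what [ab] does, and [w] as well. *)
Lemma dominating_edge_or_cycle5 x0 y0 : e x0 y0 ->
  (exists a b, e a b /\ forall v, e a v || e b v) \/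
  (exists c0 c1 c2 c3 c4, cycle5 c0 c1 c2 c3 c4).
Proof.
move=> e0; pose nbhd (p : T * T) := N p.1 :|: N p.2.
have: e (x0, y0).1 (x0, y0).2 by [].
case/(arg_maxnP (P := fun p : T * T => e p.1 p.2) (fun p => #|nbhd p|)).
case=> a b /= ab maxab.
have [/forallP dom | ] := boolP [forall v, e a v || e b v].
  by left; exists a, b.
rewrite negb_forall => /existsP[w0 w0N]; right.
have ba : e b a by rewrite e_sym.
(* Stepping out of the dominated set, which contains [a]. *)
have [x [w [xw xN wN]]] :
    exists x w, [/\ e x w, e a x || e b x & ~~ (e a w || e b w)].
  have [/existsP[x /existsP[w /and3P[]]] | no] := boolP
    [exists x, exists w, [&& e x w, e a x || e b x & ~~ (e a w || e b w)]].
    by exists x, w.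
  case/negP: w0N; pose dom v := e a v || e b v.
  apply: (connected_closed (P := dom) (x := a)) e_conn _ _ w0; rewrite /dom.
    by rewrite ba orbT.
  move=> u v uv uN; apply: contraR no => vN.
  by apply/existsP; exists u; apply/existsP; exists v; rewrite uv uN.
wlog ax : a b ab ba maxab xN wN {w0 w0N} / e a x.
  move=> IH; case/orP: (xN) => [ax|bx]; first exact: (IH a b).
  apply: (IH b a); rewrite // 1?orbC //.
  by rewrite /nbhd /= setUC.
case/norP: wN => /negbTE aw /negbTE bw.
have wx : e w x by rewrite e_sym.
have xa : e x a by rewrite e_sym.
have [/existsP[y /andP[by_ wy]] | no] := boolP [exists y, e b y && e w y].
  by exists w, x, a, b, y; rewrite /cycle5 wx xa ab by_ e_sym.
have /negP[] : ~~ (#|nbhd (a, x)| <= #|nbhd (a, b)|); last exact: (maxab (a, x)).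
rewrite -ltnNge; apply: proper_card; apply/properP; split; last first.
  by exists w; rewrite !inE /= ?xw ?orbT // aw bw.
apply/subsetP => y; rewrite !inE /= => /orP[-> // | b_y].
apply/orP; right.
have /or3P[wb | // | wy] := no_P5 wx xa ab b_y.
  by rewrite e_sym bw in wb.
by case/existsP: no; exists y; rewrite b_y.
Qed.

(** The sides [N(b)] and [N(a)] form a bipartition.  Let the set contain the
    whole side [N(b)].  Swapping a vertex of [N(a)] for one of its neighbours is
    then harmless unless a third vertex loses its only neighbour, so [a] can be
    swapped for anything when [L], the set of vertices with [a] as unique
    neighbour, is empty.  If it is not, a vertex with another neighbour is
    swapped for that one, and [a] keeps dominating [N(a)]; for a vertex of [L]
    only [a] can be swapped, and the set therefore contains the rest of [L]. *)
Lemma dominating_edge_bound a b :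
  e a b -> (forall v, e a v || e b v) ->
  secure_domination_number e <= independence_number e.
Proof.
move=> ab dom; have ba : e b a by rewrite e_sym.
pose L := [set y | e a y & [forall x, e y x ==> (x == a)]].
have LP y x : y \in L -> e y x -> x = a.
  by rewrite inE => /andP[_ /forallP/(_ x)/implyP h] /h/eqP.
have otherP y : e a y -> y \notin L -> exists2 x, e y x & x != a.
  rewrite inE => -> /=; rewrite negb_forall => /existsP[x].
  by rewrite negb_imply => /andP[]; exists x.
have sideB y : e b y = false -> e a y by move=> by_; have := dom y; rewrite by_ orbF.
have sideA y x : e a y -> e y x -> e b x.
  by move=> ay yx; have := dom x; rewrite (no_triangle ay yx).
have [L0 | [l lL]] := set_0Vmem L.
  apply: secure_domination_leq (card_neighbourhood b).
  apply: secure_dominating_swap => // v; rewrite inE => /negbTE/sideB av.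
  exists a; rewrite inE ba e_sym; split=> // w; rewrite inE => /negbTE/sideB aw _.
  have [|x wx xa] := otherP w aw; first by rewrite L0 inE.
  by exists x; rewrite inE (sideA w).
have al : e a l by move: lL; rewrite inE => /andP[].
pose S := N b :|: (L :\ l).
have disj (M : {set T}) : M \subset L -> [disjoint N b & M].
  move/subsetP=> sML; rewrite disjoint_sym disjoints_subset.
  apply/subsetP=> y /sML; rewrite !inE => /andP[ay _].
  by rewrite (no_triangle ba ay).
apply: (@secure_domination_leq _ _ S).
- apply: secure_dominating_swap => // v.
  rewrite !inE negb_or => /andP[/negbTE/sideB av]; rewrite av /= => vL.
  have va : e v a by rewrite e_sym.
  have [eq_vl | v_l] := eqVneq v l.
    (* The remaining leaf takes the place of [a]. *)
    exists a; rewrite !inE ba; split=> // w.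
    rewrite !inE negb_or => /andP[/negbTE/sideB aw].
    rewrite negb_and negbK -eq_vl => /orP[->// | wL _].
    have [|x wx xa] := otherP w aw; first by rewrite inE.
    by exists x; rewrite !inE (sideA w).
  have [|x vx xa] := otherP v av; first by rewrite inE av; move: vL; rewrite v_l.
  exists x; rewrite !inE (sideA v) //; split=> // w.
  rewrite !inE negb_or => /andP[/negbTE/sideB aw] _ _.
  by exists a; rewrite !inE ba e_sym aw [a == x]eq_sym.
(* [l] and [a] trade places between [S] and an independent set. *)
have -> : #|S| = #|(N b :\ a) :|: L|.
  rewrite /S !cardsU !disjoint_setI0 ?cards0 ?subn0; last 2 first.
  - by apply: disjointWl (disj _ (subxx _)); apply: subsetDl.
  - by apply: disj; apply: subsetDl.
  rewrite (cardsD1 a (N b)) (cardsD1 l L) lL inE ba.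
  by rewrite !add1n addSn addnS.
apply: leq_independence_number => x y; rewrite !(inE, in_setU1).
have LN u v : u \in L -> v != a -> ~~ e u v.
  by move=> uL; apply: contraNN => /(LP _ _ uL)->.
have LaN u : u \in L -> u != a.
  by rewrite inE => /andP[au _]; apply: contraTneq au => ->; rewrite no_loop.
case/orP=> [/andP[x_a bx] | xL]; case/orP=> [/andP[y_a b_y] | yL].
- by rewrite (@no_triangle x b y) // e_sym.
- by rewrite e_sym LN ?inE.
- by rewrite LN ?inE.
- by rewrite LN ?inE ?LaN ?inE.
Qed.

(** A vertex next to [c0] but to neither [c2] nor [c3] would start an induced
    path around the cycle. *)
Lemma cycle5_neighbour c0 c1 c2 c3 c4 z :
  cycle5 c0 c1 c2 c3 c4 -> e z c0 ->
  [/\ e z c1 = false, e z c4 = false & e z c3 = ~~ e z c2].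
Proof.
case/and5P=> e01 e12 e23 e34 e40 z0.
have e04 : e c0 c4 by rewrite e_sym.
rewrite (no_triangle z0 e01) (no_triangle z0 e04); split=> //.
have [z2 | nz2] := boolP (e z c2); first exact: (no_triangle z2 e23).
have := no_P5 z0 e01 e12 e23; rewrite (negbTE nz2) /=.
by rewrite (@no_triangle c0 c4 c3) // e_sym.
Qed.

(** Otherwise [v u c0] extends to an induced path along the side of the cycle
    on which [u] has no other neighbour. *)
Lemma cycle5_reached c0 c1 c2 c3 c4 u v :
  cycle5 c0 c1 c2 c3 c4 -> e u c0 -> e v u ->
  [|| e v c0, e v c1, e v c2, e v c3 | e v c4].
Proof.
move=> C u0 vu; have [u1 u4 u3] := cycle5_neighbour C u0.
case/and5P: C => e01 e12 e23 e34 e40.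
have [e04 e43] : e c0 c4 /\ e c4 c3 by split; rewrite e_sym.
have [u2 | nu2] := boolP (e u c2).
  have := no_P5 vu u0 e04 e43; rewrite u3 u2 /=.
  by case/orP=> ->; rewrite ?orbT.
have := no_P5 vu u0 e01 e12; rewrite (negbTE nu2) /=.
by case/orP=> ->; rewrite ?orbT.
Qed.

(** The [i]-th case says that [z] has the same neighbours on the cycle as the
    [i]-th cycle vertex. *)
Lemma cycle5_classes c0 c1 c2 c3 c4 z : cycle5 c0 c1 c2 c3 c4 ->
  [/\ e z c0 = false, e z c1, e z c2 = false, e z c3 = false & e z c4] \/
  [/\ e z c0, e z c1 = false, e z c2, e z c3 = false & e z c4 = false] \/
  [/\ e z c0 = false, e z c1, e z c2 = false, e z c3 & e z c4 = false] \/
  [/\ e z c0 = false, e z c1 = false, e z c2, e z c3 = false & e z c4] \/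
  [/\ e z c0, e z c1 = false, e z c2 = false, e z c3 & e z c4 = false].
Proof.
move=> C0; have C1 := cycle5_rot C0; have C2 := cycle5_rot C1.
have C3 := cycle5_rot C2; have C4 := cycle5_rot C3.
have: [|| e z c0, e z c1, e z c2, e z c3 | e z c4].
  pose near v := [|| e v c0, e v c1, e v c2, e v c3 | e v c4].
  apply: (connected_closed (P := near) (x := c1)) e_conn _ _ z; rewrite /near.
    by case/and5P: C0 => e01 *; rewrite e_sym e01.
  move=> u v uv; have vu : e v u by rewrite e_sym.
  case/or4P=> [u0|u1|u2|/orP[u3|u4]].
  - exact: cycle5_reached C0 u0 vu.
  - by case/or4P: (cycle5_reached C1 u1 vu) => [||| /orP[]] ->; rewrite ?orbT.
  - by case/or4P: (cycle5_reached C2 u2 vu) => [||| /orP[]] ->; rewrite ?orbT.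
  - by case/or4P: (cycle5_reached C3 u3 vu) => [||| /orP[]] ->; rewrite ?orbT.
  - by case/or4P: (cycle5_reached C4 u4 vu) => [||| /orP[]] ->; rewrite ?orbT.
(* Of the nonempty sets of cycle vertices, five pass the test of
   [cycle5_neighbour] at each of their elements. *)
have := @cycle5_neighbour _ _ _ _ _ z C0.
have := @cycle5_neighbour _ _ _ _ _ z C1.
have := @cycle5_neighbour _ _ _ _ _ z C2.
have := @cycle5_neighbour _ _ _ _ _ z C3.
have := @cycle5_neighbour _ _ _ _ _ z C4.
case: (e z c0); case: (e z c1); case: (e z c2); case: (e z c3);
  case: (e z c4) => n4 n3 n2 n1 n0 //= _;
  try (by case: n0); try (by case: n1); try (by case: n2); try (by case: n3);
  try (by case: n4).
- by right; left.
- by do 4 right.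
- by do 2 right; left.
- by left.
- by do 3 right; left.
Qed.

(** A vertex sees [c0] exactly when it sees one of [c2], [c3] alone among the
    other four, and the same holds for [w] since [w c1 c2 c3 c4] is a cycle. *)
Lemma cycle5_twin c0 c1 c2 c3 c4 w z :
  cycle5 c0 c1 c2 c3 c4 -> e w c1 -> e w c4 -> e z w = e z c0.
Proof.
move=> C w1 w4.
have C' : cycle5 w c1 c2 c3 c4.
  by case/and5P: C => *; apply/and5P; split=> //; rewrite e_sym.
by case: (cycle5_classes z C) => [|[|[|[|]]]] [-> z1 z2 z3 z4];
   case: (cycle5_classes z C') => [|[|[|[|]]]] [->]; rewrite ?z1 ?z2 ?z3 ?z4.
Qed.

(** [N(c4)] consists of the classes of [c0] and [c3].  A vertex next to [c0]
    is swapped for [c0], leaving [w].  A vertex of the class of [c2] can only be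
    swapped for a twin of [c3], so the rest of its class needs another one.
    If [c3] has no twin, [N(c1)], which consists of the classes of [c0] and
    [c2], is secure: the class in danger is then that of [c3] alone. *)
Lemma cycle5_twin_bound c0 c1 c2 c3 c4 w :
  cycle5 c0 c1 c2 c3 c4 -> w != c0 -> e w c1 -> e w c4 ->
  secure_domination_number e <= independence_number e.
Proof.
move=> C w_0 w1 w4; have twin z := cycle5_twin z C w1 w4.
have classes z := cycle5_classes z C.
have [e01 e12 e23 e34 e40] := and5P C.
have [e10 e21 e32] : [/\ e c1 c0, e c2 c1 & e c3 c2] by split; rewrite e_sym.
have [e1w e4w] : e c1 w /\ e c4 w by split; rewrite e_sym.
have e43 : e c4 c3 by rewrite e_sym.
have [/existsP[d /and3P[d_3 d2 d4]] | no] :=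
    boolP [exists d, [&& d != c3, e d c2 & e d c4]].
  apply: secure_domination_leq (card_neighbourhood c4).
  have twin3 z : e z d = e z c3.
    exact: (cycle5_twin z (cycle5_rot (cycle5_rot (cycle5_rot C)))).
  have cover z : z \notin N c4 -> e z c0 || e z c3.
    by rewrite inE e_sym; case: (classes z) => [|[|[|[|]]]] [-> ? ? -> ->].
  apply: secure_dominating_swap => // v vN.
  have [v0 | nv0] := boolP (e v c0).
    exists c0; rewrite inE; split=> // z /cover/orP[z0|z3] _.
      by exists w; rewrite inE (twin z).
    exists c3; rewrite inE; split=> //.
    by apply: contraTneq e32 => ->; rewrite (@no_triangle c0 c1 c2).
  have v3 : e v c3 by have := cover v vN; rewrite (negbTE nv0).
  exists c3; rewrite inE; split=> // z /cover/orP[z0|z3] _; last first.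
    by exists d; rewrite inE (twin3 z) e_sym.
  exists c0; rewrite inE; split=> //.
  by apply: contraTneq e32 => <-; rewrite (@no_triangle c0 c1 c2).
have only3 d : e d c2 -> e d c4 -> d = c3.
  move=> d2 d4; apply: contraNeq no => d_3.
  by apply/existsP; exists d; rewrite d_3 d2.
apply: secure_domination_leq (card_neighbourhood c1).
have cover z : z \notin N c1 -> e z c0 \/ e z c2 /\ z = c3.
  rewrite inE e_sym => /negbTE.
  by case: (classes z) => [|[|[|[|]]]] [// z0 z1 z2 _ z4]; rewrite ?z1 //; auto.
have c2_0 : c2 != c0.
  by apply: contraTneq e40 => <-; rewrite e_sym (@no_triangle c2 c3 c4).
apply: secure_dominating_swap => // v vN.
have [v0 | [v2 v_3]] := cover v vN.
  exists c0; rewrite inE; split=> // z /cover[z0 | [z2 _]] _.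
    by exists w; rewrite inE (twin z).
  by exists c2; rewrite inE.
exists c2; rewrite inE; split=> // z /cover[z0 | [_ z_3]] zv.
  by exists c0; rewrite inE eq_sym.
by rewrite z_3 v_3 eqxx in zv.
Qed.

(** For the bare cycle, [c0], [c1] and [c3] are secure: [c2] and [c4] can both be
    swapped for [c3], because [c1] and [c0] keep dominating them. *)
Lemma cycle5_bound c0 c1 c2 c3 c4 : cycle5 c0 c1 c2 c3 c4 ->
  secure_domination_number e <= maxn 3 (independence_number e).
Proof.
move=> C0; have C1 := cycle5_rot C0; have C2 := cycle5_rot C1.
have C3 := cycle5_rot C2; have C4 := cycle5_rot C3.
have [/forallP all_c | ] :=
  boolP [forall z, z \in [:: c0; c1; c2; c3; c4]]; last first.
  rewrite negb_forall => /existsP[w].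
  rewrite !inE !negb_or => /and5P[w_0 w_1 w_2 w_3 w_4].
  rewrite leq_max; apply/orP; right.
  case: (cycle5_classes w C0) => [|[|[|[|]]]] [w0 w1 w2 w3 w4].
  - exact: cycle5_twin_bound C0 w_0 w1 w4.
  - exact: cycle5_twin_bound C1 w_1 w2 w0.
  - exact: cycle5_twin_bound C2 w_2 w3 w1.
  - exact: cycle5_twin_bound C3 w_3 w4 w2.
  - exact: cycle5_twin_bound C4 w_4 w0 w3.
have [e01 e12 e23 e34 e40] := and5P C0.
have [e21 e43] : e c2 c1 /\ e c4 c3 by split; rewrite e_sym.
have c0_3 : c0 != c3.
  by apply: contraTneq e01 => ->; rewrite e_sym (@no_triangle c1 c2 c3).
have c1_3 : c1 != c3.
  by apply: contraTneq e40 => eq13; rewrite (@no_triangle c4 c3 c0) // -eq13 e_sym.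
apply: (@secure_domination_leq _ _ [set c0; c1; c3]); last first.
  by rewrite leq_max leq_cards3.
apply: secure_dominating_swap => // v.
have := all_c v; rewrite !inE !negb_or => v_c /andP[/andP[v_0 v_1] v_3].
have swap3 z : ~~ ((z == c0) || (z == c1) || (z == c3)) ->
    exists x, [/\ x \in [set c0; c1; c3], x != c3 & e z x].
  have := all_c z; rewrite !inE => /or4P[->|->|/eqP->|/orP[->|/eqP->]];
    rewrite ?orbT // => _.
  - by exists c1; rewrite !inE eqxx orbT.
  - by exists c0; rewrite !inE eqxx.
exists c3; rewrite !inE eqxx !orbT; split=> // [|z]; last by rewrite !inE => /swap3.
move: v_c; rewrite (negbTE v_0) (negbTE v_1) (negbTE v_3) /=.
by case/orP=> /eqP->.
Qed.

Lemma triangle_free_bound :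
  secure_domination_number e <= maxn 3 (independence_number e).
Proof.
have [/existsP[x0 /existsP[y0 e0]] | no_edge] :=
    boolP [exists x, exists y, e x y].
  have [[a [b [ab dom]]] | [c0 [c1 [c2 [c3 [c4 C]]]]]] :=
    dominating_edge_or_cycle5 e0; last exact: cycle5_bound C.
  by rewrite leq_max (dominating_edge_bound ab dom) orbT.
rewrite leq_max; apply/orP; right.
apply: secure_domination_leq (secure_dominating_setT e) _.
apply: leq_independence_number => x y _ _; apply: contra no_edge => xy.
by apply/existsP; exists x; apply/existsP; exists y.
Qed.

End TriangleFree.

Theorem theorem8 (T : finType) (e : rel T)
  (e_sym : symmetric e) (e_irr : irreflexive e)
  (e_conn : connected_graph e)
  (P5_free : induced_free e (@path_graph 5))
  (paw_free : induced_free e paw) :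
  secure_domination_number e <= maxn 3 (independence_number e).
Proof.
have [/existsP[a /existsP[b /existsP[c /and3P[ab bc ac]]]] | no] :=
    boolP [exists a, exists b, exists c, [&& e a b, e b c & e a c]].
  apply: secure_domination_leq
    (triangle_secure e_sym e_irr e_conn paw_free ab bc ac) _.
  by rewrite leq_max leq_cards3.
have no_triangle x y z : e x y -> e y z -> e x z = false.
  move=> xy yz; apply: contraNF no => xz.
  apply/existsP; exists x; apply/existsP; exists y; apply/existsP; exists z.
  by rewrite xy yz.
apply: triangle_free_bound => // v0 v1 v2 v3 v4 e01 e12 e23 e34.
have := P5_free_path e_sym e_irr P5_free e01 e12 e23 e34.
by rewrite (no_triangle _ _ _ e01 e12) (no_triangle _ _ _ e12 e23)
  (no_triangle _ _ _ e23 e34).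
Qed.
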